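(* Let $\mathscr{S}=\bm{f}(S)$ be a surface obtained from a flat reference configuration $S$ (a domain in the $(\bm{e}_1,\bm{e}_2)$ plane) via a $C^2$ deformation $\bm{f}$, let $\bm{y}:\mathscr{S}\to\mathscr{S}^\ast$ be a bending-neutral deformation of $\mathscr{S}$, and set $\bm{g}:=\bm{y}\circ\bm{f}$. Let $\bm{\nu}$ and $\bm{\nu}^\ast$ be the unit normals to $\mathscr{S}$ and $\mathscr{S}^\ast$, oriented coherently with $S$. Then normals are preserved, $$\bm{\nu}^\ast(\bm{g}(\bm{x}))=\bm{\nu}(\bm{f}(\bm{x}))\qquad\text{for all }\bm{x}\in S,$$ and $\bm{f}$ and $\bm{g}$ have one and the same bending content: $\bm{b}_{\bm{f}}=\bm{b}_{\bm{g}}$ at every point of $S$ where both are defined.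
   Context: $(\bm{e}_1,\bm{e}_2,\bm{e}_3)$ is a positively oriented orthonormal frame. A deformation $\bm{f}:S\to\mathscr{E}$ of the planar domain $S$ into Euclidean 3-space has gradient with polar decomposition $\nabla\bm{f}=\mathbf{R}_{\bm{f}}\mathbf{U}_{\bm{f}}$, where $\mathbf{R}_{\bm{f}}\in\mathsf{SO}(3)$ and $\mathbf{U}_{\bm{f}}$ is symmetric, annihilates $\bm{e}_3$ and is positive definite on the $(\bm{e}_1,\bm{e}_2)$ plane. The unit normal to $\mathscr{S}$ coherent with $S$ is $\bm{\nu}=\frac{(\nabla\bm{f})\bm{e}_1\times(\nabla\bm{f})\bm{e}_2}{|(\nabla\bm{f})\bm{e}_1\times(\nabla\bm{f})\bm{e}_2|}$; similarly for $\bm{g}$ and $\bm{\nu}^\ast$. A deformation $\bm{y}$ of $\mathscr{S}$ has surface gradient (differential along $\mathscr{S}$, extended by zero on $\bm{\nu}$) with polar decomposition $\nabla_{\mathrm s}\bm{y}=\mathbf{R}_{\bm{y}}\mathbf{U}_{\bm{y}}$, where $\mathbf{R}_{\bm{y}}$ is a field of rotations and $\mathbf{U}_{\bm{y}}$ is symmetric, annihilates $\bm{\nu}$ and is positive definite from each tangent plane to itself; $\bm{y}$ is bending-neutral if $\mathbf{R}_{\bm{y}}$ is everywhere on $\mathscr{S}$ a rotation about $\bm{\nu}$ (a uniform extra rotation is normalized to the identity by a change of frame). Vector representation of rotations: $\mathbf{R}(\bm{a})=\frac{1}{1+a^2}\{(1-a^2)\mathbf{I}+2\bm{a}\otimes\bm{a}+2\mathbf{W}(\bm{a})\}$,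 with $a^2=\bm{a}\cdot\bm{a}$ and $\mathbf{W}(\bm{a})\bm{v}=\bm{a}\times\bm{v}$; every rotation that is not a rotation by $\pi$ is $\mathbf{R}(\bm{a})$ for exactly one vector $\bm{a}$. If $\bm{a}_{\bm{f}}$ is the vector of $\mathbf{R}_{\bm{f}}$, the bending content of $\bm{f}$ is $$\bm{b}_{\bm{f}}=\frac{1}{1+(\bm{a}_{\bm{f}}\cdot\bm{e}_3)^2}\{\mathbf{I}+(\bm{a}_{\bm{f}}\cdot\bm{e}_3)\mathbf{W}(\bm{e}_3)\}(\mathbf{I}-\bm{e}_3\otimes\bm{e}_3)\bm{a}_{\bm{f}},$$ so that $\mathbf{R}_{\bm{f}}=\mathbf{R}(\bm{b}_{\bm{f}})\mathbf{R}(\bm{d}_{\bm{f}})$ with $\bm{d}_{\bm{f}}=(\bm{a}_{\bm{f}}\cdot\bm{e}_3)\bm{e}_3$; it is defined wherever $\mathbf{R}_{\bm{f}}$ is not a rotation by $\pi$. The same applies to $\bm{g}$. *)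

(* Defs.v *)
From HB Require Import structures.
From mathcomp Require Import all_boot all_order all_algebra.
From mathcomp Require Import all_classical all_reals all_analysis.

Set Implicit Arguments.
Unset Strict Implicit.
Unset Printing Implicit Defensive.

Import Order.TTheory GRing.Theory Num.Theory.
Import numFieldNormedType.Exports.

Local Open Scope classical_set_scope.
Local Open Scope ring_scope.

(* Euclidean 3-space is ['cV[R]_3] with its usual inner product and
   orientation; tensors are the matrices ['M[R]_3] acting on the left. The
   norm [`|_|] of the library on ['cV[R]_3] is the max norm, hence [enorm]. *)
Section Vectors.
Variable R : realType.
Implicit Types (a u v : 'cV[R]_3) (Q : 'M[R]_3).

Definition dot u v : R := (u^T *m v) 0 0.

Definition enorm u : R := Num.sqrt (dot u u).

(* Indices are added modulo 3 in ['I_3]. *)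
Definition cross u v : 'cV[R]_3 :=
  \col_(i < 3) (u (i + 1) 0 * v (i + 2) 0 - u (i + 2) 0 * v (i + 1) 0).

Definition tensor u v : 'M[R]_3 := u *m v^T.

Definition Wmx a : 'M[R]_3 := \matrix_(i, j) cross a (delta_mx j 0) i 0.

Lemma mul_Wmx a v : Wmx a *m v = cross a v.
Proof.
apply/colP => i; rewrite !mxE (eq_bigr (fun j =>
    a (i + 1) 0 * ((i + 2 == j)%:R * v j 0)
    - a (i + 2) 0 * ((i + 1 == j)%:R * v j 0))); last first.
  by move=> j _; rewrite !mxE !andbT mulrBl !mulrA.
rewrite sumrB -!mulr_sumr.
have sum_delta k : \sum_j (k == j)%:R * v j 0 = v k 0.
  rewrite (bigD1 k) //= eqxx mul1r big1 ?addr0 // => j.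
  by rewrite eq_sym => /negPf ->; rewrite mul0r.
by rewrite !sum_delta.
Qed.

Definition orthonormal_frame e1 e2 e3 : Prop :=
  [/\ dot e1 e1 = 1, dot e2 e2 = 1 & dot e3 e3 = 1] /\
  [/\ dot e1 e2 = 0, dot e1 e3 = 0 & dot e2 e3 = 0].

Definition positively_oriented e1 e2 e3 : Prop := 0 < dot (cross e1 e2) e3.

Definition is_rotation Q : Prop := Q^T *m Q = 1%:M /\ \det Q = 1.

Definition is_rotation_about (n : 'cV[R]_3) Q : Prop :=
  is_rotation Q /\ Q *m n = n.

Definition rotation_of a : 'M[R]_3 :=
  (1 + dot a a)^-1 *:
    ((1 - dot a a) *: 1%:M + 2 *: tensor a a + 2 *: Wmx a).

(* [F = Q *m U] is the polar decomposition of the gradient [F] of a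
   deformation of a surface with unit normal [n] at the point considered. *)
Definition polar_decomposition (n : 'cV[R]_3) (F Q U : 'M[R]_3) : Prop :=
  [/\ F = Q *m U, is_rotation Q, U^T = U, U *m n = 0 &
      forall v, dot v n = 0 -> v != 0 -> 0 < dot v (U *m v)].

Definition bending_vector e3 a : 'cV[R]_3 :=
  (1 + dot a e3 ^+ 2)^-1 *:
    ((1%:M + dot a e3 *: Wmx e3) *m (1%:M - tensor e3 e3) *m a).

End Vectors.

(* The point [x1 e1 + x2 e2] of the reference plane is represented by its
   coordinates [(x1, x2) : 'cV[R]_2]. Maps on a domain [S] of the plane are
   total functions, of which only the restriction to [S] is relevant. *)
Section Deformations.
Variable R : realType.
Implicit Types (S : set 'cV[R]_2) (f : 'cV[R]_2 -> 'cV[R]_3)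
  (y : 'cV[R]_3 -> 'cV[R]_3) (x : 'cV[R]_2).

Definition planar_domain S : Prop := [/\ open S, connected S & S !=set0].

(* In finite dimension and for [S] open, this is the usual class C^k on [S]:
   it amounts to continuity on [S] of all partial derivatives up to order k. *)
Fixpoint class_C (k : nat) S f : Prop :=
  if k is k'.+1 then
    (forall x, S x -> differentiable f x) /\
    (forall v : 'cV[R]_2, class_C k' S ('D_v f))
  else forall x, S x -> {for x, continuous f}.

Variables e1 e2 e3 : 'cV[R]_3.

(* The gradient of [f] as a tensor on 3-space, annihilating the normal to the
   reference plane. *)
Definition grad f x : 'M[R]_3 :=
  tensor ('D_(delta_mx 0 0) f x) e1 + tensor ('D_(delta_mx 1 0) f x) e2.

Definition deformation S f : Prop :=
  (forall x, S x -> differentiable f x) /\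
  (forall x, S x -> exists Q U, polar_decomposition e3 (grad f x) Q U).

(* The unit normal to the surface described by [f], coherent with the
   reference plane, at the point [f x]. *)
Definition unit_normal f x : 'cV[R]_3 :=
  let n := cross (grad f x *m e1) (grad f x *m e2) in (enorm n)^-1 *: n.

(* [G] is the surface gradient of [y] at [p = f x]: it annihilates the normal
   and [y q = y p + G (q - p) + o(q - p)] as the point [q = f z] of the surface
   tends to [p] on the surface, the neighbourhoods of [p] on the surface being
   the images under [f] of those of [x]. *)
Definition is_surface_gradient f y x (G : 'M[R]_3) : Prop :=
  (fun z => y (f z) - y (f x) - G *m (f z - f x)) =o_x (fun z => f z - f x) /\
  G *m unit_normal f x = 0.

Definition bending_neutral S f y : Prop :=
  forall x, S x -> exists G Q U,
    [/\ is_surface_gradient f y x G,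
        polar_decomposition (unit_normal f x) G Q U &
        is_rotation_about (unit_normal f x) Q].

(* The bending content is defined at [x] exactly when the polar rotation there
   has a vector, and then such a [b] is unique. *)
Definition is_bending_content f x (b : 'cV[R]_3) : Prop :=
  exists Q U a,
    [/\ polar_decomposition e3 (grad f x) Q U, Q = rotation_of a &
        b = bending_vector e3 a].

End Deformations.

(* Main.v *)
Require Import Defs.
From HB Require Import structures.
From mathcomp Require Import all_boot all_order all_algebra.
From mathcomp Require Import ring.
From mathcomp Require Import all_classical all_reals all_analysis.

Set Implicit Arguments.
Unset Strict Implicit.
Unset Printing Implicit Defensive.

Import Order.TTheory GRing.Theory Num.Theory.
Import numFieldNormedType.Exports.

Local Open Scope classical_set_scope.
Local Open Scope ring_scope.

(** Everything rests on one fact about a tensor [F = Q *m U] in polar form on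
    a surface with unit normal [n]: for tangent vectors [u] and [v],
    [cross (F *m u) (F *m v)] is a positive multiple of [Q *m cross u v]
    (lemma [polar_cross]), because the stretch [U] keeps the tangent plane
    invariant and, being positive definite there, preserves its orientation.

    Applied to [grad f x], whose polar rotation is [Q], it gives
    [unit_normal f x = Q *m e3] (lemma [unit_normal_polar]). Applied to the
    surface gradient [G] of [y], with polar rotation [Qy], it says that the
    normal of [y \o f], whose gradient is [G *m grad f x] by the chain rule, is
    [Qy] applied to the normal of [f]; bending neutrality means that [Qy] fixes
    that normal, so both normals agree (lemma [unit_normal_preserved]).

    The bending content is a function of the normal alone. Composing with a
    rotation about [e3], the drilling part, does not change the image of [e3],
    and the bending part is the rotation of least angle carrying [e3] to the
    normal [n], whose vector is [cross e3 n / (1 + dot e3 n)] (lemmas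
    [bending_vectorE] and [bending_content_normal]). Equal normals therefore
    have equal bending contents. *)

(** * Coordinates, inner and cross products *)

Section Kinematics.
Variable R : realType.
Implicit Types (u v w n : 'cV[R]_3) (Q : 'M[R]_3).

Lemma ord3P (P : 'I_3 -> Prop) : P 0 -> P 1 -> P 2 -> forall i, P i.
Proof.
move=> P0 P1 P2 [[|[|[|//]]] i].
- by rewrite (_ : Ordinal i = 0) //; apply: val_inj.
- by rewrite (_ : Ordinal i = 1) //; apply: val_inj.
- by rewrite (_ : Ordinal i = 2) //; apply: val_inj.
Qed.

Lemma sum_ord3 (V : nmodType) (F : 'I_3 -> V) : \sum_i F i = F 0 + F 1 + F 2.
Proof.
rewrite !big_ord_recr big_ord0 /= add0r.
by congr (F _ + F _ + F _); exact: val_inj.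
Qed.

Lemma dotE u v : dot u v = u 0 0 * v 0 0 + u 1 0 * v 1 0 + u 2 0 * v 2 0.
Proof. by rewrite /dot mxE sum_ord3 !mxE. Qed.

Lemma ord3D : (1 + 1 = 2 :> 'I_3) * (1 + 2 = 0 :> 'I_3) *
  (2 + 1 = 0 :> 'I_3) * (2 + 2 = 1 :> 'I_3).
Proof. by do !split; apply: val_inj. Qed.

Lemma crossE u v :
  (cross u v 0 0 = u 1 0 * v 2 0 - u 2 0 * v 1 0) *
  (cross u v 1 0 = u 2 0 * v 0 0 - u 0 0 * v 2 0) *
  (cross u v 2 0 = u 0 0 * v 1 0 - u 1 0 * v 0 0).
Proof. by rewrite !mxE !add0r !ord3D. Qed.

Lemma mulmxE3 Q v i :
  (Q *m v) i 0 = Q i 0 * v 0 0 + Q i 1 * v 1 0 + Q i 2 * v 2 0.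
Proof. by rewrite mxE sum_ord3. Qed.

Lemma det2E (A : 'M[R]_2) : \det A = A 0 0 * A 1 1 - A 0 1 * A 1 0.
Proof.
rewrite (expand_det_row _ 0) !big_ord_recl big_ord0 addr0 /cofactor.
rewrite !det_mx11 !mxE /=.
have -> : lift ord0 ord0 = 1 :> 'I_2 by exact: val_inj.
have -> : lift 1 0 = 0 :> 'I_2 by exact: val_inj.
by rewrite expr0 expr1 mul1r mulN1r mulrN.
Qed.

Lemma det3E Q : \det Q = Q 0 0 * (Q 1 1 * Q 2 2 - Q 1 2 * Q 2 1)
  - Q 0 1 * (Q 1 0 * Q 2 2 - Q 1 2 * Q 2 0)
  + Q 0 2 * (Q 1 0 * Q 2 1 - Q 1 1 * Q 2 0).
Proof.
rewrite (expand_det_row _ 0) sum_ord3 /cofactor !det2E !mxE.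
have -> : lift 0 0 = 1 :> 'I_3 by exact: val_inj.
have -> : lift 0 1 = 2 :> 'I_3 by exact: val_inj.
have -> : lift 1 0 = 0 :> 'I_3 by exact: val_inj.
have -> : lift 1 1 = 2 :> 'I_3 by exact: val_inj.
have -> : lift 2 0 = 0 :> 'I_3 by exact: val_inj.
have -> : lift 2 1 = 1 :> 'I_3 by exact: val_inj.
by rewrite /= !expr2 !addn0 !expr0 !expr1; ring.
Qed.

(** The cross product transforms by the cofactor matrix of [Q], which is
    [\det Q] times the inverse of [Q^T]; this is that rule cleared of the
    inverse. *)
Lemma cross_mulmx Q u v :
  Q^T *m cross (Q *m u) (Q *m v) = \det Q *: cross u v.
Proof.
apply/colP; apply: ord3P; rewrite mulmxE3 [RHS]mxE !crossE !mulmxE3 det3E;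
  by rewrite ![Q^T _ _]mxE; ring.
Qed.

Lemma dotC u v : dot u v = dot v u.
Proof. by rewrite !dotE; ring. Qed.

Lemma dotBr w u v : dot w (u - v) = dot w u - dot w v.
Proof. by rewrite /dot mulmxBr !mxE. Qed.

Lemma dotDr w u v : dot w (u + v) = dot w u + dot w v.
Proof. by rewrite /dot mulmxDr !mxE. Qed.

Lemma dotZr c u v : dot u (c *: v) = c * dot u v.
Proof. by rewrite /dot -scalemxAr mxE. Qed.

Lemma dotBl w u v : dot (u - v) w = dot u w - dot v w.
Proof. by rewrite dotC dotBr !(dotC w). Qed.

Lemma dotZl c u v : dot (c *: u) v = c * dot u v.
Proof. by rewrite dotC dotZr dotC. Qed.

Lemma dot_mulmx Q u v : dot (Q *m u) v = dot u (Q^T *m v).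
Proof. by rewrite /dot trmx_mul mulmxA. Qed.

Lemma crossDr w u v : cross w (u + v) = cross w u + cross w v.
Proof. by rewrite -!mul_Wmx mulmxDr. Qed.

Lemma crossZr c u v : cross u (c *: v) = c *: cross u v.
Proof. by rewrite -!mul_Wmx scalemxAr. Qed.

Lemma crossvv u : cross u u = 0.
Proof. by apply/colP; apply: ord3P; rewrite !crossE mxE mulrC subrr. Qed.

Lemma cross_cross u v w :
  cross u (cross v w) = dot u w *: v - dot u v *: w.
Proof.
by apply/colP; apply: ord3P; rewrite !(crossE, mxE, dotE); ring.
Qed.

Lemma dot_cross_cross p q u v :
  dot (cross p q) (cross u v) = dot p u * dot q v - dot p v * dot q u.
Proof. by rewrite !dotE !crossE; ring. Qed.

(** With [w = cross u v], the vector [cross n w] vanishes by the triple product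
    formula, and [cross n (cross n w) = 0] says that [w] is its own projection
    onto the line of [n]. *)
Lemma cross_plane n u v : dot n n = 1 -> dot u n = 0 -> dot v n = 0 ->
  cross u v = dot (cross u v) n *: n.
Proof.
move=> nn un vn; have := cross_cross n n (cross u v).
rewrite (cross_cross n u v) !(dotC n) un vn nn !scale0r subrr scale1r.
rewrite -mul_Wmx mulmx0 => /esym/eqP.
by rewrite subr_eq0 => /eqP.
Qed.

Lemma cross_rotation Q u v : is_rotation Q ->
  cross (Q *m u) (Q *m v) = Q *m cross u v.
Proof.
move=> [QtQ detQ]; have := cross_mulmx Q u v; rewrite detQ scale1r => <-.
by rewrite mulmxA (mulmx1C QtQ) mul1mx.
Qed.

Lemma rotation_dot Q u v : is_rotation Q -> dot (Q *m u) (Q *m v) = dot u v.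
Proof. by move=> [QtQ _]; rewrite dot_mulmx mulmxA QtQ mul1mx. Qed.

Lemma cross_neq0 u v : cross u v != 0 -> u != 0.
Proof.
apply: contraNneq => ->; apply/eqP/colP; apply: ord3P; rewrite !(crossE, mxE);
  by ring.
Qed.

(** * The oriented area element under a polar decomposition *)

(** The two sides are parallel to [Q *m n]; only the sign of the factor is at
    stake. Without the rotation it is the sign of
    [dot (cross (U *m u) (U *m v)) (cross u v)], which is the Gram determinant
    of [u] and [v] for the inner product defined by [U] on the tangent plane,
    hence positive when [u] and [v] are independent. *)
Lemma polar_cross n F Q U u v :
  polar_decomposition n F Q U -> dot n n = 1 -> dot u n = 0 -> dot v n = 0 ->
  cross u v != 0 ->
  exists2 c, 0 < c & cross (F *m u) (F *m v) = c *: (Q *m cross u v).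
Proof.
move=> [-> rotQ Usym Un Upos] nn un vn uv0.
have Utan w : dot (U *m w) n = 0.
  by rewrite dot_mulmx Usym Un /dot mulmx0 mxE.
have Uv_u : dot v (U *m u) = dot u (U *m v).
  by rewrite dotC dot_mulmx Usym.
have uUu := Upos u un (cross_neq0 uv0).
(* Up to a factor, [w] is the component of [v] orthogonal to [u] for the inner
   product of [U]; its squared length is the Gram determinant times
   [dot u (U *m u)]. *)
pose w := dot u (U *m u) *: v - dot u (U *m v) *: u.
have uw : cross u w = dot u (U *m u) *: cross u v.
  by rewrite /w -scaleNr crossDr !crossZr crossvv scaler0 addr0.
have wUw : 0 < dot w (U *m w).
  apply: Upos; first by rewrite dotBl !dotZl un vn !mulr0 subrr.
  apply: contraTneq uUu => w0; move: uw.
  rewrite w0 -mul_Wmx mulmx0 => /esym/eqP.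
  by rewrite scaler_eq0 (negPf uv0) orbF => /eqP ->; rewrite ltxx.
have gram : 0 < dot (cross (U *m u) (U *m v)) (cross u v).
  rewrite dot_cross_cross !(dotC (U *m _)) Uv_u.
  rewrite -(pmulr_rgt0 _ uUu); apply: lt_le_trans wUw _.
  rewrite /w mulmxBr -!scalemxAr !(dotBl, dotBr, dotZl, dotZr) Uv_u.
  by rewrite le_eqVlt; apply/orP; left; apply/eqP; ring.
have EU := cross_plane nn (Utan u) (Utan v).
have E := cross_plane nn un vn.
move: gram; rewrite -!mulmxA (cross_rotation _ _ rotQ) EU E.
set k' := dot (cross (U *m u) _) n; set k := dot (cross u v) n.
rewrite dotZl dotZr nn mulr1 => kk.
have k0 : k != 0 by apply: contraTneq kk => ->; rewrite mulr0 ltxx.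
exists (k' / k); last by rewrite -!scalemxAr scalerA divfK.
rewrite (_ : k' / k = k' * k / k ^+ 2); last by field.
by rewrite divr_gt0 ?exprn_even_gt0.
Qed.

Lemma direction_scale c n : 0 < c -> dot n n = 1 ->
  (enorm (c *: n))^-1 *: (c *: n) = n.
Proof.
move=> c0 nn; rewrite /enorm dotZl dotZr nn mulr1 -expr2 sqrtr_sqr gtr0_norm //.
by rewrite scalerA mulVf ?scale1r ?gt_eqF.
Qed.

(** * The bending vector as a function of the rotated normal *)

(** With [al = dot a e3] and [s = dot a a], the image [r] of [e3] satisfies
    [1 + dot e3 r = 2 (1 + al^2) / (1 + s)], and [cross e3 r] is [2 / (1 + s)]
    times the numerator [a - al e3 + al (cross e3 a)] of the bending vector, so
    the factor depending on [s] disappears from the quotient. *)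
Lemma bending_vectorE (e3 a : 'cV[R]_3) : dot e3 e3 = 1 ->
  let r := rotation_of a *m e3 in
  bending_vector e3 a = (1 + dot e3 r)^-1 *: cross e3 r.
Proof.
move=> e33 r; set al := dot a e3; set s := dot a a.
have s0 : 0 < 1 + s by rewrite /s dotE -!expr2 ltr_pwDl ?addr_ge0 ?sqr_ge0.
have al0 : 0 < 1 + al ^+ 2 by rewrite ltr_pwDl ?sqr_ge0.
have tensE u v w : tensor u v *m w = dot v w *: u.
  by rewrite /tensor -mulmxA [v^T *m w]mx11_scalar mul_mx_scalar.
have rE : r = (1 + s)^-1 *: ((1 - s) *: e3 + (2 * al) *: a + 2 *: cross a e3).
  rewrite /r /rotation_of -scalemxAl !mulmxDl -!scalemxAl mul1mx tensE mul_Wmx.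
  by rewrite scalerA.
have dr : 1 + dot e3 r = 2 * (1 + al ^+ 2) / (1 + s).
  rewrite rE dotZr !dotDr !dotZr e33 (dotC e3 a) -/al.
  rewrite [dot e3 (cross _ _)](_ : _ = 0); last first.
    by rewrite dotE !crossE; ring.
  by field; rewrite gt_eqF.
have cr : cross e3 r = (2 / (1 + s)) *: (a - al *: e3 + al *: cross e3 a).
  rewrite rE crossZr !crossDr !crossZr crossvv cross_cross e33 (dotC e3 a) -/al.
  rewrite scale1r scaler0 add0r -(scalerA 2) -scalerDr scalerA.
  by rewrite [_ * 2]mulrC [al *: _ + _]addrC.
rewrite cr dr scalerA /bending_vector -/al.
have -> : (2 * (1 + al ^+ 2) / (1 + s))^-1 * (2 / (1 + s)) = (1 + al ^+ 2)^-1.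
  by field; rewrite !gt_eqF.
congr (_ *: _).
rewrite -mulmxA mulmxDl mul1mx mulmxBl mul1mx tensE (dotC e3) -/al.
rewrite -scalemxAl mul_Wmx -scaleNr crossDr crossZr crossvv.
by rewrite scaler0 addr0.
Qed.

(** * The chain rule along the surface *)

Lemma mulmx_continuous m p (G : 'M[R]_(m.+1, p.+1)) :
  continuous (mulmx G : 'cV[R]_p.+1 -> 'cV[R]_m.+1).
Proof.
move=> u.
rewrite (_ : mulmx G = fun w : 'cV[R]_p.+1 => \sum_j w j 0 *: col j G);
  last first.
  apply/funext => w; apply/colP => i; rewrite mxE summxE.
  by apply: eq_bigr => j _; rewrite !mxE mulrC.
apply: (@cvg_big _ _ +%R 0 xpredT add_continuous _ (nbhs u)) => j _.
by apply: (@cvgZr_tmp _ _ _ (nbhs u)); exact: (@coord_continuous R _ 1 j 0 u).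
Qed.

(** A chain rule in which the outer map [y] is expanded only along the image of
    [f], as on a surface, instead of on a neighbourhood of [f x]. The remainder is controlled by [f z - f x], whose difference quotient in the
    direction [d] converges, hence is bounded. *)
Lemma derive_along_image (V : normedModType R) m p (f : V -> 'cV[R]_p.+1)
    (y : 'cV[R]_p.+1 -> 'cV[R]_m.+1) (x d : V) (G : 'M[R]_(m.+1, p.+1)) :
  differentiable f x ->
  (fun z => y (f z) - y (f x) - G *m (f z - f x)) =o_x (fun z => f z - f x) ->
  'D_d (y \o f) x = G *m 'D_d f x.
Proof.
move=> df /eqoP oG.
pose q (h : R) := h^-1 *: (f (h *: d + x) - f x).
have cq : q h @[h --> 0^'] --> 'D_d f x by exact: (diff_derivable (v := d) df).
apply: cvg_lim; first exact: norm_hausdorff.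
rewrite (_ : (fun h : R => _) = (fun h =>
    h^-1 *: (y (f (h *: d + x)) - y (f x) - G *m (f (h *: d + x) - f x))
    + G *m q h)); last first.
  by apply/funext => h /=; rewrite /q -scalemxAr -scalerDr subrK.
rewrite -[X in _ --> X]add0r; apply: cvgD; last first.
  by apply: (cvg_comp q (mulmx G) cq); exact: mulmx_continuous.
have cx : (h *: d + x) @[h --> (0:R)^'] --> x.
  rewrite -[X in _ --> X]add0r -[X in X + _](scale0r d).
  apply: cvgD; last exact: cvg_cst.
  apply: cvgZr_tmp.
  exact: nbhs_dnbhs.
apply/cvgr0Pnorm_le => e e0.
pose M := `|'D_d f x| + 1.
have M0 : 0 < M by rewrite ltr_wpDl.
have qM : \forall h \near 0^', `|q h| < M.
  by apply: (cvgr_norm_lt ('D_d f x) cq); rewrite ltrDl.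
have oh := cx _ (oG (e / M) (divr_gt0 e0 M0)).
near=> h.
rewrite normrZ.
apply: (@le_trans _ _ (e / M * `|q h|)).
  rewrite /q normrZ mulrCA ler_wpM2l //.
  near: h; exact: oh.
rewrite -mulrA ler_piMr ?(ltW e0)// mulrC ler_pdivrMr// mul1r ltW//.
near: h; exact: qM.
Unshelve. all: by end_near.
Qed.

(** * Normals and bending content of deformed surfaces *)

Section Normals.
Variables e1 e2 e3 : 'cV[R]_3.
Hypothesis he : orthonormal_frame e1 e2 e3.
Hypothesis hpos : positively_oriented e1 e2 e3.

Lemma deformed_cross F Q U : polar_decomposition e3 F Q U ->
  exists2 c, 0 < c & cross (F *m e1) (F *m e2) = c *: (Q *m e3).
Proof.
move=> pd; have [[_ _ e33] [_ e13 e23]] := he.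
have e12 := cross_plane e33 e13 e23.
have [|c c0 E] := polar_cross pd e33 e13 e23.
  apply: contraTneq hpos => ->.
  by rewrite /positively_oriented /dot trmx0 mul0mx mxE ltxx.
exists (c * dot (cross e1 e2) e3); first exact: mulr_gt0.
by rewrite E {1}e12 -scalemxAr scalerA.
Qed.

Lemma unit_normal_polar f x Q U :
  polar_decomposition e3 (grad e1 e2 f x) Q U ->
  unit_normal e1 e2 f x = Q *m e3.
Proof.
move=> pd; have [c c0 E] := deformed_cross pd.
have [_ rotQ _ _ _] := pd.
rewrite /unit_normal E direction_scale // rotation_dot //.
by have [[_ _]] := he.
Qed.

Lemma grad_comp f (y : 'cV[R]_3 -> 'cV[R]_3) x G : differentiable f x ->
  is_surface_gradient e1 e2 f y x G ->
  grad e1 e2 (y \o f) x = G *m grad e1 e2 f x.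
Proof.
move=> df [oG _].
by rewrite /grad !(derive_along_image _ df oG) mulmxDr /tensor !mulmxA.
Qed.

(** The tangent vectors [t1] and [t2] of the surface span its tangent plane, and
    their cross product is along the normal [n]. By [polar_cross] for [G], the
    cross product of their images is a positive multiple of [Qy *m n], which
    is [n]. *)
Lemma unit_normal_preserved f (y : 'cV[R]_3 -> 'cV[R]_3) x Q U G Qy Uy :
  differentiable f x ->
  polar_decomposition e3 (grad e1 e2 f x) Q U ->
  is_surface_gradient e1 e2 f y x G ->
  polar_decomposition (unit_normal e1 e2 f x) G Qy Uy ->
  is_rotation_about (unit_normal e1 e2 f x) Qy ->
  unit_normal e1 e2 (y \o f) x = unit_normal e1 e2 f x.
Proof.
move=> df pdf sG pdG [_ Qyn]; have nE := unit_normal_polar pdf.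
have [_ rotQ _ _ _] := pdf.
have [c c0 E] := deformed_cross pdf; rewrite -nE in E.
set n := unit_normal e1 e2 f x in nE E pdG Qyn *.
have nn : dot n n = 1 by rewrite nE rotation_dot //; have [[_ _]] := he.
set t1 := _ *m e1 in E; set t2 := _ *m e2 in E.
have perp u : dot u (cross t1 t2) = 0 -> dot u n = 0.
  by rewrite E dotZr => /eqP; rewrite mulf_eq0 gt_eqF // => /eqP.
have [|||c' c'0 E'] := polar_cross (u := t1) (v := t2) pdG nn.
- by apply: perp; rewrite dotE !crossE; ring.
- by apply: perp; rewrite dotE !crossE; ring.
- rewrite E scaler_eq0 gt_eqF //=; apply/eqP => n0.
  by move: nn; rewrite n0 /dot mulmx0 mxE => /eqP; rewrite eq_sym oner_eq0.
rewrite [LHS]/unit_normal (grad_comp df sG) -!mulmxA -/t1 -/t2 E' E.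
by rewrite -scalemxAr Qyn (scalerA c') direction_scale // mulr_gt0.
Qed.

(** This holds for every choice of the polar factors in [is_bending_content],
    since [unit_normal_polar] gives [Q *m e3] the same value for all of them. *)
Lemma bending_content_normal f x b : is_bending_content e1 e2 e3 f x b ->
  let n := unit_normal e1 e2 f x in b = (1 + dot e3 n)^-1 *: cross e3 n.
Proof.
move=> [Q [U [a [pd QE ->]]]] n; have [[_ _ e33] _] := he.
by rewrite bending_vectorE // -QE /n (unit_normal_polar pd).
Qed.

End Normals.

End Kinematics.

Theorem mainTheorem4 (R : realType) (e1 e2 e3 : 'cV[R]_3)
    (he : orthonormal_frame e1 e2 e3) (hpos : positively_oriented e1 e2 e3)
    (S : set 'cV[R]_2) (hS : planar_domain S)
    (f : 'cV[R]_2 -> 'cV[R]_3)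
    (hf : deformation e1 e2 e3 S f) (hfC2 : class_C 2 S f)
    (y : 'cV[R]_3 -> 'cV[R]_3) (hy : bending_neutral e1 e2 S f y) :
  let g := y \o f in
  (forall x, S x -> unit_normal e1 e2 g x = unit_normal e1 e2 f x) /\
  (forall x, S x -> forall bf bg : 'cV[R]_3,
     is_bending_content e1 e2 e3 f x bf ->
     is_bending_content e1 e2 e3 g x bg -> bf = bg).
Proof.
move=> g; have [df polf] := hf.
have normalE x : S x -> unit_normal e1 e2 g x = unit_normal e1 e2 f x.
  move=> Sx; have [Q [U pdf]] := polf x Sx.
  have [G [Qy [Uy [sG pdG rotQy]]]] := hy x Sx.
  exact: (unit_normal_preserved he hpos (df x Sx) pdf sG pdG rotQy).
split=> // x Sx bf bg /(bending_content_normal he hpos) -> .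
by move=> /(bending_content_normal he hpos) ->; rewrite normalE.
Qed.
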